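(* Let $d$ be a homogeneous distance on $\mathbb{H}$ with profile $\phi: K \rightarrow [0,+\infty)$. Assume that BCP holds in $(\mathbb{H},d)$ and that $\phi \in C^2(\operatorname{int}(K))$. Then $\langle \nabla\phi(w) , w\rangle < 0$ for all $w\in \operatorname{int}(K) \setminus \{0\}$, $\phi(w) < \phi(0)$ for all $w\in K \setminus \{0\}$, and the Hessian $H\phi(0)$ of $\phi$ at $0$ is negative semi-definite. Moreover, if $H\phi$ is assumed to be differentiable at $0$, then $H\phi(0)$ is negative definite.
   Context: The first Heisenberg group $\mathbb{H}$ is $\mathbb{R}^2\times\mathbb{R}$ with group law $(v,z)\cdot(v',z') := (v+v', z+z'+\omega(v,v')/2)$, where $\omega(v,v') := v_1v'_2-v_2v'_1$, and dilations $\delta_t(v,z) := (tv,t^2z)$, $t\ge 0$. A distance $d$ on $\mathbb{H}$ is homogeneous if it is left-invariant ($d(p\cdot q,p\cdot q')=d(q,q')$) and $d(\delta_t(p),\delta_t(q))=t\,d(p,q)$ for all $t>0$. Such a distance induces the Euclidean topology. Profile: let $B:=\{p\in\mathbb{H}: d(0,p)\le 1\}$ be the closed unit ball of a homogeneous distance $d$ centered at the origin, $\pi(v,z):=v$ and $K:=\pi(B)$. It is known that $K\subset\mathbb{R}^2$ is compact, convex, $K=-K$, $0\in\operatorname{int}(K)$, and that there is a (unique) bounded function $\phi:K\to[0,+\infty)$, locally Lipschitz on $\operatorname{int}(K)$, such that $B=\{(v,z)\in\mathbb{H}: v\in K,\ -\phi(-v)\le z\le\phi(v)\}$. This $\phi$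 is called the profile of $d$. $\langle\cdot,\cdot\rangle$ is the Euclidean scalar product. BCP: in a metric space, balls are closed balls $B(p,r)=\{q: d(p,q)\le r\}$, $0<r<\infty$ (a ball comes with its center and radius). A family $\mathcal{B}$ of balls is a Besicovitch family if the center of each $B\in\mathcal{B}$ belongs to no other $B'\in\mathcal{B}$, $B'\ne B$, and $\bigcap_{B\in\mathcal{B}}B\neq\emptyset$. The space satisfies the Besicovitch Covering Property (BCP) if there is a constant $C\ge1$ such that $\operatorname{Card}\mathcal{B}\le C$ for every Besicovitch family $\mathcal{B}$ of balls. *)

(* Defs.v *)
From HB Require Import structures.
From mathcomp Require Import all_boot all_order all_algebra.
From mathcomp Require Import all_classical all_reals all_analysis.

Set Implicit Arguments.
Unset Strict Implicit.
Unset Printing Implicit Defensive.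

Import Order.TTheory GRing.Theory Num.Theory.
Import numFieldNormedType.Exports.

Local Open Scope classical_set_scope.
Local Open Scope ring_scope.

Section metric.
Context {R : realType} {T : Type}.
Implicit Types (d : T -> T -> R) (F : set (T * R)).

Definition is_distance d : Prop :=
  [/\ forall x y, 0 <= d x y,
      forall x y, d x y = 0 <-> x = y,
      forall x y, d x y = d y x &
      forall x y z, d x z <= d x y + d y z].

Definition closed_dball d (b : T * R) : set T := [set q | d b.1 q <= b.2].

(* A ball comes with its center and radius, so a family of balls is a set of
   (center, radius) pairs and distinct balls are distinct pairs. *)
Definition besicovitch_family d F : Prop :=
  [/\ forall b, F b -> 0 < b.2,
      forall b b', F b -> F b' -> b' <> b -> ~ closed_dball d b' b.1 &
      exists q, forall b, F b -> closed_dball d b q].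

Definition BCP d : Prop :=
  exists2 C : nat, (1 <= C)%N & forall F, besicovitch_family d F -> (F #<= `I_C)%card.

End metric.

Section heisenberg.
Context {R : realType}.

Definition heis : Type := ('rV[R]_2 * R)%type.

Definition omega (v v' : 'rV[R]_2) : R := v 0 0 * v' 0 1 - v 0 1 * v' 0 0.

Definition heis_mul (p q : heis) : heis :=
  (p.1 + q.1, p.2 + q.2 + omega p.1 q.1 / 2).

Definition heis_dil (t : R) (p : heis) : heis := (t *: p.1, t ^+ 2 * p.2).

Definition heis0 : heis := (0, 0).

Implicit Types d : heis -> heis -> R.

Definition homogeneous_distance d : Prop :=
  [/\ is_distance d,
      forall p q q', d (heis_mul p q) (heis_mul p q') = d q q' &
      forall t p q, 0 < t -> d (heis_dil t p) (heis_dil t q) = t * d p q].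

Definition unit_dball d : set heis := closed_dball d (heis0, 1).

Definition profile_dom d : set 'rV[R]_2 := fst @` unit_dball d.

(* phi is a total function, but only its values on profile_dom d matter. *)
Definition is_profile d (phi : 'rV[R]_2 -> R) : Prop :=
  [/\ forall v, profile_dom d v -> 0 <= phi v,
      [bounded phi v | v in profile_dom d],
      forall v : 'rV[R]_2, (profile_dom d)° v ->
        exists2 U, nbhs v U & [lipschitz phi w | w in U] &
      unit_dball d =
        [set p | profile_dom d p.1 /\ - phi (- p.1) <= p.2 <= phi p.1]].

End heisenberg.

Arguments heis R : clear implicits.

Section calculus.
Context {R : realType} {n : nat}.
Implicit Types (f : 'rV[R]_n.+1 -> R) (u v x : 'rV[R]_n.+1).

Definition dotv u v : R := \sum_i u 0 i * v 0 i.

Definition grad f x : 'rV[R]_n.+1 := \row_i 'D_(delta_mx 0 i) f x.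

Definition hess f x : 'M[R]_n.+1 :=
  \matrix_(i, j) 'D_(delta_mx 0 j) (fun y => 'D_(delta_mx 0 i) f y) x.

(* For U open: f is twice Frechet differentiable on U with continuous second
   derivative. *)
Definition C2_on (U : set 'rV[R]_n.+1) f : Prop :=
  forall x, U x ->
    [/\ differentiable f x, differentiable (grad f) x &
        {for x, continuous (hess f)}].

Definition quad_form (A : 'M[R]_n.+1) v : R := (v *m A *m v^T) 0 0.

Definition neg_semidefinite (A : 'M[R]_n.+1) : Prop :=
  forall v, quad_form A v <= 0.

Definition neg_definite (A : 'M[R]_n.+1) : Prop :=
  forall v, v != 0 -> quad_form A v < 0.

End calculus.

(* Main.v *)
Require Import Defs.
From HB Require Import structures.
From mathcomp Require Import all_boot all_order all_algebra.
From mathcomp Require Import all_classical all_reals all_analysis.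
From mathcomp Require Import ring lra.
Set Implicit Arguments.
Unset Strict Implicit.
Unset Printing Implicit Defensive.
Import Order.TTheory GRing.Theory Num.Theory.
Import numFieldNormedType.Exports.
Local Open Scope classical_set_scope.
Local Open Scope ring_scope.

(** Write [F x u = omega x u / 2 - <grad phi x, u>] ([horiz]).  At the top point
    [q = (x, phi x)] of the unit sphere, [F x u > 0] forces [q . delta_e (u, s)]
    to lie outside the unit ball for small [e > 0].  Hence, if [x_1, x_2, ...] satisfy
    [F x_n x_m < 0] for each [m] and all large [n], the balls of radius [r_n]
    centred at [delta_(r_n) (x_n, phi x_n)^-1], with [r_n] growing fast enough
    along a suitable subsequence, contain [0] and contain no other centre: BCP
    fails.  BCP thus forbids any curve [c] with [F (c t) (c s) < 0] for
    [0 < t << s << 1].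

    Constant curves give [<grad phi x, x> <= 0]; in case of equality, straight
    lines from [x] give [F x = 0].  If moreover [x <> 0], the Hessian of [phi] at
    [x] maps [x] to a multiple of its rotation by a right angle, and as it is
    symmetric it takes a positive value at some [a] near [x]; then [x + s a] is a
    forbidden curve.  At [x = 0], the curves [s v] exclude [H v v > 0], and
    [s v + s^2 b], where [b] is [v] rotated, exclude [H v v = 0]. *)

(** * Calculus along curves *)

Lemma is_derive_gt0_near (R : realType) (f : R -> R) (l : R) :
  is_derive (0 : R) 1 f l -> f 0 = 0 -> 0 < l ->
  \forall t \near (0:R)^'+, 0 < f t.
Proof.
move=> [df fl] f0 l0.
have fc : h^-1 *: (f h - f 0) @[h --> (0:R)^'] --> l.
  rewrite -fl /derive; move: df; rewrite /derivable /=.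
  under eq_fun do rewrite [_%:A]mulr1 addr0; exact.
have /cvg_dnbhs_at_right fc' := fc.
have := (cvgrPdist_lt _ _).1 fc' _ l0.
move=> H; near=> t.
have t0 : 0 < t by near: t; exact: nbhs_right_gt.
have : `|l - t^-1 *: (f t - f 0)| < l by near: t; exact: H.
rewrite f0 subr0 /GRing.scale /= ltr_distlC subrr => /andP[+ _].
by rewrite pmulr_rgt0 ?invr_gt0.
Unshelve. all: by end_near. Qed.

Lemma is_derive_diff_comp (R : realType) (V W : normedModType R) (f : V -> W)
    (c : R -> V) (s : R) (dc : V) :
  differentiable f (c s) -> is_derive s 1 c dc ->
  is_derive s 1 (f \o c) ('d f (c s) dc).
Proof.
move=> df [dc1 <-].
have c_diff : differentiable c s by exact/derivable1_diffP.
have fc_diff : differentiable (f \o c) s by exact: differentiable_comp.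
apply: DeriveDef; first exact/derivable1_diffP.
by rewrite deriveE// diff_comp//= deriveE.
Qed.

Lemma dotv_grad (R : realType) n (f : 'rV[R]_n.+1 -> R) (x u : 'rV[R]_n.+1) :
  differentiable f x -> dotv (grad f x) u = 'd f x u.
Proof.
move=> df; rewrite [in RHS](row_sum_delta u) linear_sum /dotv.
by apply: eq_bigr => i _; rewrite linearZ /= !mxE deriveE// mulrC.
Qed.

Lemma diff_grad (R : realType) n (f : 'rV[R]_n.+1 -> R) (x u : 'rV[R]_n.+1) i :
  differentiable (grad f) x ->
  ('d (grad f) x u) 0 i = \sum_j hess f x i j * u 0 j.
Proof.
move=> df; rewrite [in LHS](row_sum_delta u) linear_sum summxE.
apply: eq_bigr => j _; rewrite linearZ /= !mxE -deriveE//.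
rewrite derive_mx ?mxE; last exact: diff_derivable.
rewrite mulrC; congr (_ * _).
by congr ('D_ _ _ _); apply/funext => y; rewrite mxE.
Qed.

Lemma is_derive_line (R : realType) (V : normedModType R) (x u : V) (s : R) :
  is_derive s 1 (fun t : R => x + t *: u) u.
Proof.
have idd : differentiable (id : R -> R) s by [].
have dl : derivable (fun t : R => t *: u) s 1.
  by apply: diff_derivable; exact: differentiableZl.
have := is_deriveD (is_derive_cst x s 1) (derivableP dl).
have dll : differentiable (fun t : R => t *: u) s by exact: differentiableZl.
by rewrite (@deriveE _ R _ _ _ 1 dll) diffZl//= diff_val scale1r add0r.
Qed.

Lemma is_derive_parabola (R : realType) (V : normedModType R) (x u v : V)
    (s : R) :
  is_derive s 1 (fun t : R => x + t *: u + t ^+ 2 *: v) (u + (2 * s) *: v).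
Proof.
have dX : is_derive s 1 (fun t : R => t ^+ 2) (2 * s).
  have := is_deriveX 2 (is_derive_id s 1); rewrite [_ *: _]mulr1.
  by congr is_derive; apply/funext => t; rewrite expr2.
have diffX := (derivable1_diffP _ _).1 (@ex_derive _ _ _ _ _ _ _ dX).
have dl : differentiable (fun t : R => t ^+ 2 *: v) s by exact: differentiableZl.
have dl1 : derivable (fun t : R => t ^+ 2 *: v) s 1 by exact: diff_derivable.
have := is_deriveD (is_derive_line x u s) (derivableP dl1).
by rewrite (@deriveE _ R _ _ _ 1 dl) diffZl//= -deriveE// derive_val.
Qed.

(** * Symmetry of second derivatives *)

(** The terms are grouped as the increment over [[0, h]] of [t |-> f (x + h v + t u) - f (x + t u)],
    the form to which the mean value theorem applies. *)
Definition second_difference (R : realType) (V : normedModType R) (f : V -> R)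
    (x u v : V) (h : R) : R :=
  f (x + h *: v + h *: u) - f (x + h *: u) - (f (x + h *: v) - f x).

Lemma second_differenceC (R : realType) (V : normedModType R) (f : V -> R)
    (x u v : V) :
  second_difference f x u v = second_difference f x v u.
Proof.
by apply/funext => h; rewrite /second_difference (addrAC x); ring.
Qed.

(** With [g] the derivative of [f] along [u], the mean value theorem turns the second difference
    into [h * (g (x + h v + c u) - g (x + c u))] with [0 < c < h]. Expanding both values of [g] to
    first order at [x], the terms in [c u] cancel and [h * 'd g x v] remains, up to [o(h)]. *)
Lemma second_difference_cvg (R : realType) (V : normedModType R) (f : V -> R)
    (x u v : V) :
  (\forall y \near x, differentiable f y) ->
  differentiable (fun y => 'D_u f y) x ->
  second_difference f x u v h / h ^+ 2
    @[h --> (0:R)^'+] --> 'd (fun y => 'D_u f y) x v.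
Proof.
move=> fx dg; set g := (fun y => 'D_u f y) in dg *.
apply/cvgrPdist_le => e e0.
(* The remainders at [h v + c u] and [c u] are together at most [eC * h * (2 |u| + |v|)]; the added
   1 keeps the divisor positive. *)
have C0 : 0 < `|u| *+ 2 + `|v| + 1 by rewrite ltr_wpDl// addr_ge0// mulrn_wge0.
have eC0 : 0 < e / (`|u| *+ 2 + `|v| + 1) by rewrite divr_gt0.
have /diff_locallyP[_ /eqaddoP/(_ _ eC0)] := dg.
set eC := e / _ in eC0 * => /nbhs_normP[r1 /= r10 rem].
have /nbhs_normP[r2 /= r20 fxd] := fx.
pose r := Num.min r1 r2.
have r0 : 0 < r by rewrite lt_min r10.
near=> h.
have h0 : 0 < h by near: h; exact: nbhs_right_gt.
have hr : h * (`|u| + `|v| + 1) < r.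
  rewrite -ltr_pdivlMr ?ltr_wpDl ?addr_ge0//.
  by near: h; apply: nbhs_right_lt; rewrite divr_gt0// ltr_wpDl ?addr_ge0.
have small t b : 0 <= t <= h -> 0 <= b <= h -> `|b *: v + t *: u| < r.
  move=> /andP[t0 th] /andP[b0 bh]; apply: le_lt_trans hr.
  rewrite (le_trans (ler_normD _ _))// !normrZ !ger0_norm// !mulrDr mulr1 -addrA.
  by rewrite addrCA lerD ?ler_wpM2r// ler_wpDr ?ler_wpM2r// ltW.
have diff t b : 0 <= t <= h -> 0 <= b <= h ->
    differentiable f (x + b *: v + t *: u).
  move=> th bh; apply: fxd; rewrite /= opprD opprD addrA addrA subrr sub0r.
  by rewrite -opprD normrN (lt_le_trans (small _ _ th bh))// /r ge_min lexx orbT.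
pose psi (b t : R) := f (x + b *: v + t *: u).
have dpsi t b : 0 <= t <= h -> 0 <= b <= h ->
    is_derive t 1 (psi b) (g (x + b *: v + t *: u)).
  move=> th bh; rewrite /g deriveE; last exact: diff.
  apply: (is_derive_diff_comp (c := fun t => x + b *: v + t *: u)).
    exact: diff.
  exact: is_derive_line.
have rg z : `|z| < r -> `|g (x + z) - g x - 'd g x z| <= eC * `|z|.
  move=> zr; have := rem z; rewrite /= sub0r normrN => /(_ (lt_le_trans zr _)).
  by rewrite !fctE /= (addrC z) opprD addrA; apply; rewrite ge_min lexx.
have h0h : 0 <= h <= h by rewrite lexx ltW.
have [|||c] := @MVT R (psi h - psi 0)
    (fun t => g (x + h *: v + t *: u) - g (x + 0 *: v + t *: u)) 0 h.
- exact: h0.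
- move=> t; rewrite in_itv /= => /andP[t0 th].
  have t0h : 0 <= t <= h by rewrite !ltW.
  by apply: is_deriveB; apply: dpsi => //; rewrite lexx ltW.
- apply: derivable_within_continuous => t; rewrite in_itv /= => t0h.
  by apply: derivableB; apply: ex_derive; apply: dpsi => //; rewrite lexx ltW.
rewrite in_itv /= => /andP[c0 ch].
rewrite /second_difference !fctE /psi !scale0r !addr0 subr0 => ->.
rewrite ?scale0r ?addr0.
have c0h : 0 <= c <= h by rewrite !ltW.
have := rg _ (small c h c0h h0h).
have := rg _ (small c 0 c0h _); rewrite lexx ltW// => /(_ isT).
rewrite scale0r add0r addrA.
set A := g (x + h *: v + _); set B := g (x + c *: u).
set D := 'd g x v; set E := 'd g x u.
have -> : 'd g x (h *: v + c *: u) = h * D + c * E.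
  by rewrite linearD !linearZ.
have -> : 'd g x (c *: u) = c * E by rewrite linearZ.
move=> HB HA.
have -> : (A - B) * h / h ^+ 2 = (A - B) / h by field; rewrite gt_eqF.
rewrite ler_distlC.
suff : `|A - B - h * D| <= h * e.
  rewrite ler_distl => /andP[H1 H2].
  by rewrite ler_pdivlMr// ler_pdivrMr// mulrBl mulrDl !(mulrC _ h) H1 H2.
have -> : A - B - h * D = (A - g x - (h * D + c * E)) - (B - g x - c * E).
  by ring.
rewrite (le_trans (ler_normB _ _))// (le_trans (lerD HA HB))//.
rewrite -mulrDr /eC mulrAC ler_pdivrMr// (mulrC h) -mulrA ler_pM2l//.
rewrite (le_trans (lerD (ler_normD _ _) (lexx _)))// !normrZ !gtr0_norm//.
have := ler_wpM2r (normr_ge0 u) (ltW ch).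
rewrite mulr2n !mulrDr mulr1; move: h0.
by clear; move: (c * _) (h * `|u|) (h * `|v|) => ? ? ?; lra.
Unshelve. all: by end_near. Qed.

(** Both mixed partials are limits of the same quotient, as the second difference is symmetric in
    its two directions. *)
Lemma hess_sym (R : realType) n (f : 'rV[R]_n.+1 -> R) (x : 'rV[R]_n.+1) i j :
  (\forall y \near x, differentiable f y) -> differentiable (grad f) x ->
  hess f x i j = hess f x j i.
Proof.
move=> fx gx.
have gradE k : (fun y => 'D_(delta_mx 0 k) f y) = (fun y => grad f y 0 k).
  by apply/funext => y; rewrite mxE.
have dk k : differentiable (fun y => 'D_(delta_mx 0 k) f y) x.
  rewrite gradE.
  apply: (differentiable_comp (g := fun M : 'rV[R]_n.+1 => M 0 k)) => //.
  exact: differentiable_coord.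
rewrite !mxE !deriveE//.
have cij := second_difference_cvg (u := delta_mx 0 i) (v := delta_mx 0 j)
  fx (dk i).
have cji := second_difference_cvg (u := delta_mx 0 j) (v := delta_mx 0 i)
  fx (dk j).
rewrite second_differenceC in cij.
exact: (cvg_unique _ cij cji).
Qed.

(** * The Heisenberg group *)

Section heisenberg_group.
Context {R : realType}.
Implicit Types (p q : heis R) (t : R).

Definition heis_inv p : heis R := (- p.1, - p.2).

Lemma omegaDl (u v w : 'rV[R]_2) : omega (u + v) w = omega u w + omega v w.
Proof. by rewrite /omega !mxE; ring. Qed.

Lemma omegaDr (u v w : 'rV[R]_2) : omega w (u + v) = omega w u + omega w v.
Proof. by rewrite /omega !mxE; ring. Qed.

Lemma omegaZl t (u v : 'rV[R]_2) : omega (t *: u) v = t * omega u v.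
Proof. by rewrite /omega !mxE; ring. Qed.

Lemma omegaZr t (u v : 'rV[R]_2) : omega u (t *: v) = t * omega u v.
Proof. by rewrite /omega !mxE; ring. Qed.

Lemma omegavv (u : 'rV[R]_2) : omega u u = 0.
Proof. by rewrite /omega; ring. Qed.

Lemma heis_mulV p : heis_mul (heis_inv p) p = heis0.
Proof.
rewrite /heis_mul /heis_inv /heis0 /= addNr addNr add0r -scaleN1r omegaZl omegavv.
by rewrite mulr0 mul0r.
Qed.

Lemma heis_mul0 p : heis_mul p heis0 = p.
Proof.
case: p => v z; rewrite /heis_mul /heis0 /= !addr0 -(scale0r 0) omegaZr.
by rewrite !mul0r addr0.
Qed.

Lemma heis_dil0 t : heis_dil t (heis0 : heis R) = heis0.
Proof. by rewrite /heis_dil /heis0 /= scaler0 mulr0. Qed.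

Lemma heis_dil_dil s t p : heis_dil s (heis_dil t p) = heis_dil (s * t) p.
Proof. by rewrite /heis_dil /= scalerA exprMn mulrA. Qed.

Lemma heis_dil1 p : heis_dil 1 p = p.
Proof. by case: p => v z; rewrite /heis_dil /= scale1r expr1n mul1r. Qed.

Lemma heis_invK p : heis_inv (heis_inv p) = p.
Proof. by case: p => v z; rewrite /heis_inv /= !opprK. Qed.

End heisenberg_group.

Section homogeneous_distance.
Context {R : realType} {d : heis R -> heis R -> R}.
Context (dP : homogeneous_distance d).

Lemma hdist_ge0 p q : 0 <= d p q. Proof. by case: dP => -[]. Qed.

Lemma hdist_sym p q : d p q = d q p. Proof. by case: dP => -[]. Qed.

Lemma hdist_triangle p q r : d p r <= d p q + d q r.
Proof. by case: dP => -[]. Qed.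

Lemma hdist_mul p q q' : d (heis_mul p q) (heis_mul p q') = d q q'.
Proof. by case: dP. Qed.

Lemma hdist_dil t p q : 0 < t -> d (heis_dil t p) (heis_dil t q) = t * d p q.
Proof. by case: dP => _ _; exact. Qed.

Lemma hdist_dil0 t p : 0 <= t -> d heis0 (heis_dil t p) = t * d heis0 p.
Proof.
rewrite le_eqVlt => /predU1P[<-|t0].
  case: dP => -[_ d0 _ _] _ _.
  rewrite mul0r /heis_dil scale0r expr0n mul0r; exact/d0.
by rewrite -hdist_dil// heis_dil0.
Qed.

Lemma hdist_inv p q : d (heis_inv p) q = d heis0 (heis_mul p q).
Proof. by rewrite -(hdist_mul p) -{1}(heis_invK p) heis_mulV. Qed.

Lemma hdist_mul_le p q : d heis0 (heis_mul p q) <= d heis0 p + d heis0 q.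
Proof.
rewrite (le_trans (hdist_triangle _ p _))// lerD2l.
by rewrite -{1}(heis_mul0 p) hdist_mul.
Qed.

(** Rescaling to the unit ball: [q] lies in the ball of radius [t] centred at [delta_t p^-1] exactly
    when [p . delta_(1/t) q] lies in the unit ball. *)
Lemma hdist_dil_inv t p q : 0 < t ->
  d (heis_dil t (heis_inv p)) q = t * d heis0 (heis_mul p (heis_dil t^-1 q)).
Proof.
move=> t0; rewrite -hdist_inv -hdist_dil// heis_dil_dil divff ?gt_eqF//.
by rewrite heis_dil1.
Qed.

End homogeneous_distance.

(** * A local obstruction to BCP *)

(** Slope of the horizontal lift of [u] at the top point over [x], minus the slope of the graph of
    [phi]. It vanishes for all [u] exactly when the horizontal plane is tangent to the graph, that
    is, when the point is characteristic. *)
Definition horiz (R : realType) (phi : 'rV[R]_2 -> R) (x u : 'rV[R]_2) : R :=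
  omega x u / 2 - dotv (grad phi x) u.

Lemma dotvZr (R : realType) n (t : R) (u v : 'rV[R]_n.+1) :
  dotv u (t *: v) = t * dotv u v.
Proof. 
by rewrite /dotv big_distrr; apply: eq_bigr => i _; rewrite !mxE /=; ring.
Qed.

Lemma dotvDr (R : realType) n (u v w : 'rV[R]_n.+1) :
  dotv u (v + w) = dotv u v + dotv u w.
Proof. 
by rewrite /dotv -big_split; apply: eq_bigr => i _; rewrite !mxE mulrDr.
Qed.

Lemma horizZ (R : realType) (phi : 'rV[R]_2 -> R) x (t : R) u :
  horiz phi x (t *: u) = t * horiz phi x u.
Proof. by rewrite /horiz omegaZr dotvZr; ring. Qed.

Lemma horizD (R : realType) (phi : 'rV[R]_2 -> R) x u v :
  horiz phi x (u + v) = horiz phi x u + horiz phi x v.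
Proof. by rewrite /horiz omegaDr dotvDr; ring. Qed.

Section profile.
Context {R : realType} {d : heis R -> heis R -> R} {phi : 'rV[R]_2 -> R}.
Context (dP : homogeneous_distance d).
Context (phiP : is_profile d phi).

Lemma profile_ballE p : d heis0 p <= 1 <->
  profile_dom d p.1 /\ - phi (- p.1) <= p.2 <= phi p.1.
Proof.
case: phiP => _ _ _ /seteqP[H1 H2]; split; first exact: (H1 p).
exact: (H2 p).
Qed.

(** The vertical segment over [v] is nonempty, since [v] is the projection of a point of the ball;
    hence its upper end belongs to the ball. *)
Lemma profile_top v : profile_dom d v -> d heis0 (v, phi v) <= 1.
Proof.
move=> [p /profile_ballE[Kv /andP[z1 z2]] <-].
by apply/profile_ballE; split => //=; rewrite lexx andbT (le_trans z1).
Qed.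

(** Dilating the top point over [v] by [t <= 1] keeps it in the unit ball, hence below the graph. *)
Lemma profile_ray_le v t : profile_dom d v -> 0 <= t <= 1 ->
  t ^+ 2 * phi v <= phi (t *: v).
Proof.
move=> Kv /andP[t0 t1].
have /profile_ballE[_ /andP[_ //]] : d heis0 (heis_dil t (v, phi v)) <= 1.
by rewrite (hdist_dil0 dP)// mulr_ile1// ?(hdist_ge0 dP)// profile_top.
Qed.

(** The height [f e] of the product above the graph vanishes at [e = 0]. The dilation makes the
    contribution of [p.2] quadratic in [e], so the derivative of [f] at 0 is [horiz phi x p.1]. *)
Lemma outside_unit_dball x p : differentiable phi x -> 0 < horiz phi x p.1 ->
  \forall e \near (0 : R)^'+, 1 < d heis0 (heis_mul (x, phi x) (heis_dil e p)).
Proof.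
move=> dphi hor.
pose f e := phi x + e ^+ 2 * p.2 + omega x (e *: p.1) / 2 - phi (x + e *: p.1).
have dX : is_derive (0:R) 1 (fun t : R => t ^+ 2) 0.
  have := is_deriveX 2 (is_derive_id (0:R) 1); rewrite expr1 mulr0 scale0r.
  by congr is_derive; apply/funext => t; rewrite expr2.
have dl := is_derive_line x p.1 0.
have x0 : x + 0 *: p.1 = x by rewrite scale0r addr0.
have dc : is_derive (0:R) 1 (phi \o (fun t => x + t *: p.1)) ('d phi x p.1).
  by rewrite -[in 'd phi x]x0; apply: is_derive_diff_comp => //; rewrite x0.
have df : is_derive (0:R) 1 f (horiz phi x p.1).
  have -> : f = (fun t => t ^+ 2) * cst p.2 + id * cst (omega x p.1 / 2)
             + cst (phi x) - (phi \o (fun t => x + t *: p.1)).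
    by apply/funext => e; rewrite /f !fctE omegaZr /=; ring.
  have df := is_deriveB (is_deriveD (is_deriveD
    (is_deriveM dX (is_derive_cst p.2 (0:R) 1))
    (is_deriveM (is_derive_id (0:R) 1) (is_derive_cst (omega x p.1 / 2) (0:R) 1)))
    (is_derive_cst (phi x) (0:R) 1)) dc.
  apply: (@is_derive_eq _ _ _ _ _ _ _ _ df).
  rewrite /horiz (@dotv_grad R 1 phi x p.1 dphi). rewrite !scaler0 !add0r addr0.
  by rewrite [_ *: _]mulr1.
have f0 : f 0 = 0.
  by rewrite /f x0 omegaZr; ring.
have := is_derive_gt0_near df f0 hor; apply: filterS => e fe.
rewrite ltNge; apply/negP => /profile_ballE[_ /andP[_]] /=.
by move: fe; rewrite /f subr_gt0 => /lt_le_trans/[apply]; rewrite ltxx.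
Qed.

(** Balls are added one at a time. The invariant is that [horiz phi (c t)] is positive at the
    projection of every centre so far once [t] is small, which leaves room for the next ball. *)
Lemma besicovitch_extend k (c : R -> 'rV[R]_2) :
  (forall x, (profile_dom d)° x -> differentiable phi x) ->
  (\forall s \near (0:R)^'+, (profile_dom d)° (c s)) ->
  (\forall s \near (0:R)^'+, \forall t \near (0:R)^'+,
    horiz phi (c t) (c s) < 0) ->
  exists f : nat -> heis R * R,
    (forall i, (i < k)%N -> [/\ 0 < (f i).2, d (f i).1 heis0 <= (f i).2 &
      \forall t \near (0:R)^'+, 0 < horiz phi (c t) (f i).1.1]) /\
    (forall i j, (i < j < k)%N ->
      (f i).2 < d (f j).1 (f i).1 /\ (f j).2 < d (f j).1 (f i).1).
Proof.
move=> dphi Kc hc; elim: k => [|k [f [f1 f2]]].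
  by exists (fun _ => (heis0, 0)); split=> [//|i j]; rewrite ltn0 andbF.
have hf : \forall t \near (0:R)^'+, forall i : 'I_k,
    0 < horiz phi (c t) (f i).1.1.
  by apply: filter_forall => i; case: (f1 i).
have [t [Kt ht hft]] : exists t, [/\ (profile_dom d)° (c t),
    \forall s \near (0:R)^'+, horiz phi (c s) (c t) < 0 &
    forall i : 'I_k, 0 < horiz phi (c t) (f i).1.1].
  by apply: (@filter_ex _ (0:R)^'+); near=> t; split; near: t.
set q : heis R := (c t, phi (c t)).
(* The new radius is [1 / e]: a small [e] makes it dominate the earlier radii and puts the rescaled
   earlier centres outside the unit ball. *)
have [e [e0 he]] : exists e : R, 0 < e /\ forall i : 'I_k,
    (f i).2 <= e^-1 /\ 1 < d heis0 (heis_mul q (heis_dil e (f i).1)).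
  apply: (@filter_ex _ (0:R)^'+); near=> e; split.
    by near: e; exact: nbhs_right_gt.
  near: e; apply: filter_forall => i; have [r0 _ _] := f1 i (ltn_ord i).
  have r0' : 0 < (f i).2^-1 by rewrite invr_gt0.
  near=> h; split.
    have h0 : 0 < h by near: h; exact: nbhs_right_gt.
    have hr : h <= (f i).2^-1 by near: h; exact: nbhs_right_le.
    by rewrite -(invrK (f i).2) lef_pV2 ?posrE.
  by near: h; apply: outside_unit_dball; [exact/dphi|exact: hft].
pose b : heis R * R := (heis_dil e^-1 (heis_inv q), e^-1).
have ei0 : 0 < e^-1 by rewrite invr_gt0.
exists (fun i => if (i < k)%N then f i else b); split=> [i|i j].
  case: ifPn => [ik _|_ _]; first exact: f1.
  split; rewrite /b //=.
    rewrite -[heis0](heis_dil0 e^-1) hdist_dil// ger_pMr// hdist_inv//.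
    rewrite heis_mul0.
    by apply: profile_top; exact: interior_subset.
  (* The new centre projects to [- e^-1 *: c t]; the minus sign turns the negative value in [ht]
     into the positive one of the invariant. *)
  apply: filterS ht => s.
  by rewrite scalerN -scaleNr horizZ mulNr oppr_gt0 pmulr_rlt0.
rewrite ltnS => /andP[ij jk]; rewrite (leq_trans ij jk); case: ifPn => [jk'|kj].
  by apply: f2; rewrite ij.
have [H1 H2] := he (Ordinal (leq_trans ij jk)).
rewrite /b /= hdist_dil_inv// invrK.
suff H : e^-1 < e^-1 * d heis0 (heis_mul q (heis_dil e (f i).1)).
  by split=> //; rewrite (le_lt_trans H1).
by rewrite ltr_pMr.
Unshelve. all: by end_near. Qed.

Lemma BCP_horiz (c : R -> 'rV[R]_2) : BCP d ->
  (forall x, (profile_dom d)° x -> differentiable phi x) ->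
  (\forall s \near (0:R)^'+, (profile_dom d)° (c s)) ->
  ~ (\forall s \near (0:R)^'+, \forall t \near (0:R)^'+,
      horiz phi (c t) (c s) < 0).
Proof.
move=> [C _ hC] dphi Kc hc.
have [f [f1 f2]] := besicovitch_extend C.+1 dphi Kc hc.
have f2' i j : (i < C.+1)%N -> (j < C.+1)%N -> i != j ->
    (f i).2 < d (f i).1 (f j).1.
  move=> iC jC; rewrite neq_ltn => /orP[ij|ji].
    by rewrite (hdist_sym dP); case: (f2 i j) => //; rewrite ij.
  by case: (f2 j i) => //; rewrite ji.
have f0 i : (i < C.+1)%N -> d (f i).1 (f i).1 = 0.
  by case: dP => -[_ d0 _ _] _ _ _; exact/d0.
have : (`I_C.+1 #<= `I_C)%card.
  (* Equal balls with distinct indices would have a radius smaller than the distance of their centre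
     to itself. *)
  have finj : {in `I_C.+1 &, injective f}.
    move=> i j /[!inE]/= iC jC fij; apply/eqP; apply: contraT => ij.
    have := f2' i j iC jC ij; rewrite -fij f0//.
    by have [/ltW] := f1 i iC; rewrite leNgt => /negbTE ->.
  rewrite -(card_le_eql (inj_card_eq finj)); apply: hC; split.
  - by move=> _ [i iC <-]; case: (f1 i iC).
  - move=> _ _ [i iC <-] [j jC <-] fji; rewrite /closed_dball /=; apply/negP.
    rewrite -ltNge; apply: f2' => //; apply/eqP => ij; apply: fji.
    by rewrite ij.
  - by exists heis0 => _ [i iC <-]; case: (f1 i iC).
by rewrite card_le_II ltnn.
Qed.

End profile.

(** * First-order variation of the horizontal form *)

Lemma is_derive_lt0_near (R : realType) (f : R -> R) (l : R) :
  is_derive (0 : R) 1 f l -> f 0 = 0 -> l < 0 ->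
  \forall t \near (0:R)^'+, f t < 0.
Proof.
move=> df f0 l0.
have /= := is_derive_gt0_near (is_deriveN df) _ _; rewrite !fctE f0 oppr0.
by rewrite oppr_gt0 => /(_ erefl l0); apply: filterS => t; rewrite oppr_gt0.
Qed.

Lemma is_derive_near_right (R : realType) (V : normedModType R) (f : R -> V)
    (l : V) (A : set V) :
  is_derive (0 : R) 1 f l -> nbhs (f 0) A -> \forall t \near (0:R)^'+, A (f t).
Proof.
move=> [df _] Af.
have /differentiable_continuous fc := (derivable1_diffP _ _).1 df.
exact: (cvg_at_right_filter fc Af).
Qed.

Lemma is_derive_coord (R : realType) n (F : R -> 'rV[R]_n) (dF : 'rV[R]_n)
    (s : R) i :
  is_derive s 1 F dF -> is_derive s 1 (fun t => F t 0 i) (dF 0 i).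
Proof.
move=> [dFs <-]; apply: DeriveDef; first exact: ((derivable_mxP _ _ _).1 dFs).
by rewrite derive_mx// mxE.
Qed.

Lemma dotv2E (R : realType) (u v : 'rV[R]_2) :
  dotv u v = u 0 0 * v 0 0 + u 0 1 * v 0 1.
Proof.
rewrite /dotv !big_ord_recl big_ord0 addr0.
by rewrite (_ : lift ord0 ord0 = 1)//; exact/val_inj.
Qed.

(** Derivative of [y |-> horiz phi y u] at [x] along [a]. As a bilinear form in [a] and [u] it is
    [omega / 2] minus the Hessian; when the Hessian is symmetric, these are its antisymmetric and
    symmetric parts. *)
Definition dhoriz (R : realType) (phi : 'rV[R]_2 -> R) (x a u : 'rV[R]_2) : R :=
  omega a u / 2 - dotv ('d (grad phi) x a) u.

(** The term [t ^+ 2 *: b] has zero velocity at 0, so [b] does not enter the derivative. *)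
Lemma is_derive_horiz (R : realType) (phi : 'rV[R]_2 -> R) (x a b u : 'rV[R]_2) :
  differentiable (grad phi) x ->
  is_derive (0:R) 1 (fun t => horiz phi (x + t *: a + t ^+ 2 *: b) u)
    (dhoriz phi x a u).
Proof.
move=> dg; pose c (t : R) := x + t *: a + t ^+ 2 *: b.
have c0 : c 0 = x by rewrite /c scale0r expr0n scale0r !addr0.
have dc : is_derive (0:R) 1 c a.
  by have := is_derive_parabola x a b 0; rewrite mulr0 scale0r addr0.
have dgc : is_derive (0:R) 1 (grad phi \o c) ('d (grad phi) x a).
  by rewrite -[in 'd _ x]c0; apply: is_derive_diff_comp => //; rewrite c0.
have K k := is_derive_cst (k : R) (0:R) 1.
have C i := is_derive_coord i dc.
have G i := is_derive_coord i dgc.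
have df := is_deriveB
  (is_deriveM (is_deriveB (is_deriveM (C 0) (K (u 0 1)))
                          (is_deriveM (C 1) (K (u 0 0)))) (K 2^-1))
  (is_deriveD (is_deriveM (G 0) (K (u 0 0))) (is_deriveM (G 1) (K (u 0 1)))).
rewrite (_ : (fun t : R => _) = ((fun t => c t 0 0) * cst (u 0 1) -
    (fun t => c t 0 1) * cst (u 0 0)) * cst 2^-1 -
    ((fun t => (grad phi \o c) t 0 0) * cst (u 0 0) +
    (fun t => (grad phi \o c) t 0 1) * cst (u 0 1))); last first.
  by apply/funext => t; rewrite !fctE /horiz dotv2E.
apply: (@is_derive_eq _ _ _ _ _ _ _ _ df).
rewrite /dhoriz dotv2E /omega !scaler0 !add0r /GRing.scale /=; ring.
Qed.

Lemma dhorizE (R : realType) (phi : 'rV[R]_2 -> R) (x a u : 'rV[R]_2) :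
  differentiable (grad phi) x ->
  dhoriz phi x a u = (a 0 0 * u 0 1 - a 0 1 * u 0 0) / 2 -
    ((hess phi x 0 0 * a 0 0 + hess phi x 0 1 * a 0 1) * u 0 0 +
     (hess phi x 1 0 * a 0 0 + hess phi x 1 1 * a 0 1) * u 0 1).
Proof.
move=> dg; rewrite /dhoriz dotv2E !diff_grad// !big_ord_recl !big_ord0 !addr0.
by rewrite (_ : lift ord0 ord0 = 1)//; exact/val_inj.
Qed.

Lemma dhorizZl (R : realType) (phi : 'rV[R]_2 -> R) (x a u : 'rV[R]_2) t :
  dhoriz phi x (t *: a) u = t * dhoriz phi x a u.
Proof. by rewrite /dhoriz omegaZl linearZ !dotv2E !mxE; ring. Qed.

Lemma dhorizDl (R : realType) (phi : 'rV[R]_2 -> R) (x a b u : 'rV[R]_2) :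
  dhoriz phi x (a + b) u = dhoriz phi x a u + dhoriz phi x b u.
Proof. by rewrite /dhoriz omegaDl linearD !dotv2E !mxE; ring. Qed.

Lemma dhorizZr (R : realType) (phi : 'rV[R]_2 -> R) (x a u : 'rV[R]_2) t :
  dhoriz phi x a (t *: u) = t * dhoriz phi x a u.
Proof. by rewrite /dhoriz omegaZr dotvZr; ring. Qed.

Lemma dhorizDr (R : realType) (phi : 'rV[R]_2 -> R) (x a u v : 'rV[R]_2) :
  dhoriz phi x a (u + v) = dhoriz phi x a u + dhoriz phi x a v.
Proof. by rewrite /dhoriz omegaDr dotvDr; ring. Qed.

Lemma quad_formE (R : realType) (A : 'M[R]_2) (v : 'rV[R]_2) :
  quad_form A v = (A 0 0 * v 0 0 + A 0 1 * v 0 1) * v 0 0 +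
                  (A 1 0 * v 0 0 + A 1 1 * v 0 1) * v 0 1.
Proof.
rewrite /quad_form !mxE !big_ord_recl !big_ord0 !addr0 !mxE.
rewrite !big_ord_recl !big_ord0 !addr0.
by rewrite (_ : lift ord0 ord0 = 1); [ring|exact/val_inj].
Qed.

Lemma dhoriz_quad_form (R : realType) (phi : 'rV[R]_2 -> R) (x a : 'rV[R]_2) :
  differentiable (grad phi) x -> dhoriz phi x a a = - quad_form (hess phi x) a.
Proof.
by move=> dg; rewrite (dhorizE _ _ dg) quad_formE; move: (hess phi x) => H; ring.
Qed.

(** * Plane geometry and elementary inequalities *)

(** The clockwise quarter turn; this orientation makes [omega v (perp v)] negative for [v != 0]. *)
Definition perp (R : realType) (w : 'rV[R]_2) : 'rV[R]_2 :=
  \row_i (if i == 0 then w 0 1 else - w 0 0).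

Lemma rV2_neq0 (R : realType) (w : 'rV[R]_2) :
  w != 0 -> 0 < w 0 0 ^+ 2 + w 0 1 ^+ 2.
Proof.
move=> w0; rewrite lt_neqAle addr_ge0 ?sqr_ge0// andbT eq_sym.
apply: contra_neq w0 => /eqP; rewrite paddr_eq0 ?sqr_ge0// !sqrf_eq0.
move=> /andP[/eqP w0 /eqP w1]; apply/rowP => i; rewrite mxE.
case: i => -[|[|//]] i.
- by rewrite -[RHS]w0; congr (w _ _); exact/val_inj.
- by rewrite -[RHS]w1; congr (w _ _); exact/val_inj.
Qed.

Lemma quadratic_pos (R : realType) (m k : R) : m != 0 ->
  exists t, 0 < t * m + t ^+ 2 * k.
Proof.
move=> m0; have k1 : 0 < 1 + `|k| by rewrite ltr_wpDr.
(* This [t] satisfies [t * m = t ^+ 2 * (1 + |k|)], which outweighs [t ^+ 2 * k] whatever the sign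
   of [k]. *)
exists (m / (1 + `|k|)).
have -> : m / (1 + `|k|) * m + (m / (1 + `|k|)) ^+ 2 * k =
    (m / (1 + `|k|)) ^+ 2 * (1 + `|k| + k) by field; rewrite gt_eqF.
apply: mulr_gt0.
  by rewrite exprn_even_gt0//= mulf_neq0// invr_eq0 gt_eqF.
by have := ler_norm (- k); rewrite normrN; lra.
Qed.

(** With [H] the Hessian, its symmetry and the last hypothesis at [a = perp x] give [<H x, perp x> =
    <H (perp x), x> = omega (perp x) x / 2]. The value is therefore [omega x (perp x)]. The proof
    reads [H x] off the two basis vectors. *)
Lemma dhoriz_critical_perp (R : realType) (phi : 'rV[R]_2 -> R) (x : 'rV[R]_2) :
  differentiable (grad phi) x -> hess phi x 0 1 = hess phi x 1 0 ->
  (forall a, dhoriz phi x a x = 0) ->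
  dhoriz phi x x (perp x) = - (x 0 0 ^+ 2 + x 0 1 ^+ 2).
Proof.
move=> dg sym crit.
move: (crit (\row_i (i == 0)%:R)) (crit (\row_i (i == 1)%:R)) sym.
rewrite !(dhorizE _ _ dg); move: (hess phi x) => A {dg crit}.
rewrite !mxE /= => e0 e1 sym.
have {}e0 : A 0 0 * x 0 0 = x 0 1 / 2 - A 1 0 * x 0 1 by lra.
have {}e1 : A 1 1 * x 0 1 = - x 0 0 / 2 - A 0 1 * x 0 0 by lra.
by rewrite e0 e1 sym; field.
Qed.

Lemma dhoriz_antisym (R : realType) (phi : 'rV[R]_2 -> R) (x a b : 'rV[R]_2) :
  differentiable (grad phi) x -> hess phi x 0 1 = hess phi x 1 0 ->
  dhoriz phi x a b - dhoriz phi x b a = omega a b.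
Proof.
move=> dg sym; rewrite /omega !(dhorizE _ _ dg) sym; move: (hess phi x) => A.
by field.
Qed.

Lemma omega_perp (R : realType) (v : 'rV[R]_2) :
  omega v (perp v) = - (v 0 0 ^+ 2 + v 0 1 ^+ 2).
Proof. by rewrite /omega !mxE /=; ring. Qed.

(** The last inequality is that of the arithmetic and geometric means of 1 and [z]. *)
Lemma half_between (R : realType) (z : R) : 0 <= z < 1 ->
  [/\ 2^-1 <= (1 + z) / 2, (1 + z) / 2 < 1 & z < ((1 + z) / 2) ^+ 2].
Proof.
move=> /andP[z0 z1]; split; try lra.
have : 0 < (1 - z) ^+ 2 by rewrite exprn_gt0// subr_gt0.
by rewrite !expr2; lra.
Qed.

(** * Profiles of distances satisfying BCP *)

Section profile_domain.
Context {R : realType} {d : heis R -> heis R -> R} {phi : 'rV[R]_2 -> R}.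
Context (dP : homogeneous_distance d).

(** The sum on the right covers both signs of [a], dilations having positive factors only. *)
Lemma hdist_horizontal_le (a : R) (v : 'rV[R]_2) :
  d heis0 (a *: v, 0) <= `|a| * (d heis0 (v, 0) + d heis0 (- v, 0)).
Proof.
have dil0 (t : R) u : 0 <= t -> d heis0 (t *: u, 0) = t * d heis0 (u, 0).
  by move=> t0; rewrite -(hdist_dil0 dP)// /heis_dil /= mulr0.
have [a0|/ltW a0] := leP 0 a.
  by rewrite ger0_norm// dil0// ler_wpM2l// lerDl (hdist_ge0 dP).
rewrite ler0_norm// -(opprK a) scaleNr -scalerN opprK dil0 ?oppr_ge0//.
by rewrite ler_wpM2l ?oppr_ge0// lerDr (hdist_ge0 dP).
Qed.

(** A horizontal step along each axis yields a product that projects to [u], and each step costs at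
    most a constant times its coordinate. *)
Lemma hdist_plane_bounded : exists2 M, 0 <= M & forall u : 'rV[R]_2,
  exists z, d heis0 (u, z) <= M * `|u|.
Proof.
pose e i : 'rV[R]_2 := delta_mx 0 i.
pose M i := d heis0 (e i, 0) + d heis0 (- e i, 0).
have M0 i : 0 <= M i by rewrite addr_ge0 ?(hdist_ge0 dP).
exists (M 0 + M 1) => [|u]; first exact: addr_ge0.
have := hdist_mul_le dP (u 0 0 *: e 0, 0) (u 0 1 *: e 1, 0).
have -> : heis_mul (u 0 0 *: e 0, 0) (u 0 1 *: e 1, 0) =
    (u, omega (u 0 0 *: e 0) (u 0 1 *: e 1) / 2) :> heis R.
  rewrite /heis_mul /= !add0r; congr (_, _).
  rewrite [RHS]row_sum_delta !big_ord_recl big_ord0 addr0.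
  by rewrite (_ : lift ord0 ord0 = 1)//; exact/val_inj.
move=> le_uz; exists (omega (u 0 0 *: e 0) (u 0 1 *: e 1) / 2).
have norm_coord i : `|u 0 i| <= `|u|.
  rewrite [leRHS]/Num.Def.normr/= mx_normrE.
  exact: (le_bigmax _ (fun ij => `|u ij.1 ij.2|) (0, i)).
rewrite (le_trans le_uz)// mulrDl lerD//.
  by rewrite (le_trans (hdist_horizontal_le _ _))// mulrC ler_wpM2l ?M0.
by rewrite (le_trans (hdist_horizontal_le _ _))// mulrC ler_wpM2l ?M0.
Qed.

Lemma profile_dom_ray (v : 'rV[R]_2) (t : R) :
  profile_dom d v -> 0 <= t < 1 -> (profile_dom d)° (t *: v).
Proof.
move=> [p Bp <-] /andP[t0 t1].
have [M M0 le_M] := hdist_plane_bounded.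
have M1 : 0 < M + 1 by rewrite ltr_wpDl.
(* The dilated point is within [t] of the origin, and a group step projecting to [y - t *: p.1] can
   be chosen of cost at most [M * |y - t *: p.1|]; this radius keeps that cost below [1 - t]. *)
apply: (nbhs_normP (t *: p.1) (profile_dom d)).2; exists ((1 - t) / (M + 1)) => /=.
  by rewrite divr_gt0// subr_gt0.
move=> y /=; rewrite distrC ltr_pdivlMr// => yt.
have [z uz] := le_M (y - t *: p.1).
exists (heis_mul (heis_dil t p) (y - t *: p.1, z)); last first.
  by rewrite /= addrC subrK.
rewrite /unit_dball /closed_dball /= (le_trans (hdist_mul_le dP _ _))//.
rewrite (hdist_dil0 dP)//.
have tp : t * d heis0 p <= t by rewrite ler_piMr.
rewrite (le_trans (lerD tp uz))// -lerBrDl (le_trans _ (ltW yt))// mulrC.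
by rewrite ler_wpM2l// lerDl.
Qed.

Lemma profile_dom0 : profile_dom d 0.
Proof.
exists heis0 => //; rewrite /unit_dball /closed_dball /=.
by case: dP => -[_ d0 _ _] _ _; rewrite (d0 _ _).2.
Qed.

Lemma profile_dom_int0 : (profile_dom d)° 0.
Proof.
rewrite -(scale0r 0); apply: profile_dom_ray profile_dom0 _.
by rewrite lexx ltr01.
Qed.

End profile_domain.

(** * Radial monotonicity, maximum and Hessian of the profile under BCP *)

Section BCP_profile.
Context {R : realType} {d : heis R -> heis R -> R} {phi : 'rV[R]_2 -> R}.
Context (dP : homogeneous_distance d) (phiP : is_profile d phi) (dBCP : BCP d).
Context (phi_C2 : C2_on (profile_dom d)° phi).

Let K := (profile_dom d)°.

Lemma profile_diff x : K x -> differentiable phi x.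
Proof. by case/phi_C2. Qed.

Lemma profile_diff_grad x : K x -> differentiable (grad phi) x.
Proof. by case/phi_C2. Qed.

Lemma curve_in_int (x a b : 'rV[R]_2) : K x ->
  \forall s \near (0:R)^'+, K (x + s *: a + s ^+ 2 *: b).
Proof.
move=> Kx; apply: (is_derive_near_right (is_derive_parabola x a b 0)).
rewrite scale0r expr0n scale0r !addr0.
by apply: open_nbhs_nbhs; split => //; exact: open_interior.
Qed.

Lemma horiz_near_lt0 (x a u : 'rV[R]_2) : K x -> horiz phi x u < 0 ->
  \forall t \near (0:R)^'+, horiz phi (x + t *: a) u < 0.
Proof.
move=> Kx xu0.
have := is_derive_near_right (A := [set y : R | y < 0])
  (is_derive_horiz a 0 u (profile_diff_grad Kx)).
rewrite scale0r expr0n scale0r !addr0 => /(_ (lt_nbhsl xu0)).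
by apply: filterS => t; rewrite scaler0 addr0.
Qed.

Lemma horiz_self_ge0 x : K x -> 0 <= horiz phi x x.
Proof.
move=> Kx; rewrite leNgt; apply/negP => xx0.
apply: (BCP_horiz dP phiP (c := cst x) dBCP profile_diff).
  by near=> s.
by near=> s; near=> t.
Unshelve. all: by end_near. Qed.

(** On the line, [horiz phi x (x + s u) = s * horiz phi x u]. If this is negative, it stays so when
    the base point moves slightly from [x] to [c t], with [s] fixed. *)
Lemma horiz_self_eq0 x : K x -> horiz phi x x = 0 ->
  forall u, horiz phi x u = 0.
Proof.
move=> Kx xx0.
suff ge0 u : 0 <= horiz phi x u.
  move=> u; apply/eqP; rewrite eq_le ge0 andbT.
  by have := ge0 (-1 *: u); rewrite horizZ mulN1r oppr_ge0.
rewrite leNgt; apply/negP => xu0.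
apply: (BCP_horiz dP phiP (c := fun s => x + s *: u) dBCP profile_diff).
  by have := curve_in_int u 0 Kx; apply: filterS => s; rewrite scaler0 addr0.
near=> s; apply: horiz_near_lt0 => //.
by rewrite horizD xx0 add0r horizZ pmulr_rlt0.
Unshelve. all: by end_near. Qed.


(** Along [c s = x + s a + s^2 b] with [s] fixed, [t |-> horiz phi (c t) (c s)] vanishes at 0 and
    has derivative [s * dhoriz phi x a a + s^2 * dhoriz phi x a b] there. If either value were
    negative, [c] would be a forbidden curve. *)
Lemma BCP_dhoriz (x a b : 'rV[R]_2) : K x ->
  (forall u, horiz phi x u = 0) -> dhoriz phi x a x = 0 ->
  dhoriz phi x a a <= 0 -> dhoriz phi x a b <= 0 ->
  dhoriz phi x a a = 0 /\ dhoriz phi x a b = 0.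
Proof.
move=> Kx x0 ax aa ab; apply: contrapT => neg.
have {neg} aab : (dhoriz phi x a a < 0) || (dhoriz phi x a b < 0).
  rewrite !lt_neqAle aa ab !andbT -negb_and; apply/negP => /andP[/eqP ? /eqP ?].
  exact: neg.
apply: (BCP_horiz dP phiP (c := fun s => x + s *: a + s ^+ 2 *: b) dBCP
  profile_diff); first exact: curve_in_int.
near=> s.
have s0 : 0 < s by near: s; exact: nbhs_right_gt.
apply: is_derive_lt0_near (is_derive_horiz a b _ (profile_diff_grad Kx)) _ _.
  by rewrite scale0r expr0n scale0r !addr0.
rewrite !dhorizDr !dhorizZr ax add0r.
have s20 : 0 < s ^+ 2 by rewrite exprn_gt0.
case/orP: aab => [aa0|ab0].
  by rewrite ltr_wnDr ?pmulr_rle0 ?pmulr_rlt0.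
by rewrite ltr_wnDl ?pmulr_rle0 ?pmulr_rlt0.
Unshelve. all: by end_near. Qed.

Lemma hess_profile_sym x : K x -> hess phi x 0 1 = hess phi x 1 0.
Proof.
move=> Kx; apply: hess_sym; last exact: profile_diff_grad.
have : nbhs x K by apply: open_nbhs_nbhs; split => //; exact: open_interior.
by apply: filterS => y; exact: profile_diff.
Qed.

(* At a characteristic point [x], the function [y |-> horiz phi y y >= 0] has a
   minimum, so its derivative vanishes. *)
Lemma dhoriz_self_eq0 x a : K x -> (forall u, horiz phi x u = 0) ->
  dhoriz phi x a x = 0.
Proof.
move=> Kx x0.
suff ge0 b : 0 <= dhoriz phi x b x.
  apply/eqP; rewrite eq_le ge0 andbT.
  by have := ge0 (-1 *: a); rewrite dhorizZl mulN1r oppr_ge0.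
rewrite leNgt; apply/negP => bx0.
(* This is [horiz phi y y] at [y = x + t b], split by linearity so that each second argument is
   constant in [t]. *)
pose f t := horiz phi (x + t *: b + t ^+ 2 *: 0) x +
  t * horiz phi (x + t *: b + t ^+ 2 *: 0) b.
have D u := is_derive_horiz b 0 u (profile_diff_grad Kx).
have df := is_deriveD (D x) (is_deriveM (is_derive_id (0:R) 1) (D b)).
have := is_derive_lt0_near df.
rewrite !fctE scale0r scale0r expr0n scale0r !addr0 mul0r add0r !x0 scale0r !addr0.
move=> /(_ erefl bx0) fneg.
have [t [ft Kt]] : exists t, f t < 0 /\ K (x + t *: b + t ^+ 2 *: 0).
  apply: (@filter_ex _ (0:R)^'+); near=> t; split; near: t => //.
  exact: curve_in_int.
move: (horiz_self_ge0 Kt); rewrite leNgt => /negP; apply.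
by move: ft; rewrite /f scaler0 addr0 => ft; rewrite horizD horizZ.
Unshelve. all: by end_near. Qed.

Lemma horiz_self_gt0 x : K x -> x != 0 -> 0 < horiz phi x x.
Proof.
move=> Kx xn0; rewrite lt_neqAle horiz_self_ge0// andbT eq_sym.
apply/eqP => /(horiz_self_eq0 Kx) x0.
have dg := profile_diff_grad Kx.
have H := hess_profile_sym Kx.
have ax a := dhoriz_self_eq0 a Kx x0.
have xp := dhoriz_critical_perp dg H ax.
have x2 := rV2_neq0 xn0.
have [|t tpos] := quadratic_pos (m := x 0 0 ^+ 2 + x 0 1 ^+ 2)
  (- dhoriz phi x (perp x) (perp x)); first by rewrite gt_eqF.
(* As [dhoriz phi x _ x] vanishes, only the terms [t * dhoriz phi x x (perp x)] and
   [t^2 * dhoriz phi x (perp x) (perp x)] survive in [dhoriz phi x a a]; [t] is chosen to make their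
   sum negative. *)
pose a := x + t *: perp x.
have aa : dhoriz phi x a a < 0.
  rewrite [in X in dhoriz _ _ _ X]/a dhorizDr dhorizZr ax add0r /a dhorizDl.
  by rewrite dhorizZl xp -oppr_gt0; congr (0 < _): tpos; ring.
have [|aa0 _] := BCP_dhoriz (b := 0) Kx x0 (ax a) (ltW aa).
  by rewrite -(scale0r x) dhorizZr mul0r.
by move: aa; rewrite aa0 ltxx.
Qed.

(** At [c *: v] the radial slope has the sign of [- horiz phi (c *: v) (c *: v)]. The mean value
    point [c] is positive even for [s = 0], so the decrease is strict from the origin on. *)
Lemma profile_ray_decr v s t : profile_dom d v -> v != 0 ->
  0 <= s -> s < t -> t < 1 -> phi (t *: v) < phi (s *: v).
Proof.
move=> Kv v0 s0 st t1.
have Kr r : 0 <= r -> r <= t -> K (0 + r *: v).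
  move=> r0 rt; rewrite add0r; apply: (profile_dom_ray dP Kv).
  by rewrite r0 (le_lt_trans rt).
pose f := phi \o (fun r : R => 0 + r *: v).
have df r : 0 <= r -> r <= t ->
    is_derive r 1 f (dotv (grad phi (0 + r *: v)) v).
  move=> r0 rt; rewrite dotv_grad; last exact/profile_diff/Kr.
  by apply: is_derive_diff_comp; [exact/profile_diff/Kr|exact: is_derive_line].
have [|||c] := @MVT R f (fun r => dotv (grad phi (0 + r *: v)) v) s t.
- exact: st.
- move=> r; rewrite in_itv /= => /andP[sr rt].
  by apply: df; rewrite ltW// (le_lt_trans s0).
- apply: derivable_within_continuous => r; rewrite in_itv /= => /andP[sr rt].
  by apply: ex_derive; apply: df => //; rewrite (le_trans s0).
rewrite in_itv /= => /andP[sc ct]; rewrite /f /= !add0r => E.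
have c0 : 0 < c by rewrite (le_lt_trans s0).
have Kc : K (c *: v) by rewrite -[_ *: _]add0r; apply: Kr; exact: ltW.
have cv0 : c *: v != 0 by rewrite scaler_eq0 gt_eqF.
have := horiz_self_gt0 Kc cv0.
rewrite /horiz omegavv mul0r sub0r oppr_gt0 dotvZr pmulr_rlt0// => neg.
by rewrite -subr_lt0 E nmulr_rlt0// subr_gt0.
Qed.

(** Since [w] may lie on the boundary, where radial monotonicity stops short, a dilation bound is
    used as well: if [phi w >= phi 0], then [phi (t *: w) >= t^2 * phi w] exceeds [phi (w / 2)] for
    [t] close to 1, against monotonicity. *)
Lemma profile_max w : profile_dom d w -> w != 0 -> phi w < phi 0.
Proof.
move=> Kw w0; rewrite ltNge; apply/negP => le0w.
have half0 : 0 <= (2^-1 : R) by rewrite invr_ge0.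
have half1 : (2^-1 : R) < 1 by rewrite invf_lt1// ltr1n.
have half_lt : phi (2^-1 *: w) < phi 0.
  have half_gt0 : 0 < (2^-1 : R) by rewrite invr_gt0.
  by have := profile_ray_decr Kw w0 (lexx 0) half_gt0 half1; rewrite scale0r.
set p := phi (2^-1 *: w) in half_lt.
have p0 : 0 <= p.
  case: phiP => phi0 _ _ _; apply: phi0; apply: interior_subset.
  by apply: (profile_dom_ray dP Kw); rewrite half0.
set q := phi w in le0w.
have pq : p < q by exact: lt_le_trans le0w.
have q0 : 0 < q by exact: le_lt_trans pq.
(* This [t] is at least 1/2, so monotonicity from [w / 2] gives [phi (t *: w) <= p], while
   [t^2 > p / q] gives [t^2 * q > p]. *)
pose t := (1 + p / q) / 2.
have [|th t1 pqt] := @half_between R (p / q).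
  by rewrite divr_ge0 ?(ltW q0)//= ltr_pdivrMr// mul1r.
rewrite -/t in th t1 pqt.
have t0 : 0 <= t by exact: le_trans th.
have tp : phi (t *: w) <= p.
  move: th; rewrite le_eqVlt => /predU1P[<-//|th].
  exact/ltW/profile_ray_decr.
have := profile_ray_le dP phiP Kw (t := t).
rewrite t0 (ltW t1) => /(_ isT) le_t.
have := le_trans le_t tp; rewrite leNgt => /negP; apply.
by rewrite -ltr_pdivrMr.
Qed.

(** At the origin the equality [horiz phi x x = 0] is automatic, so the origin is characteristic. *)
Lemma horiz0 u : horiz phi 0 u = 0.
Proof.
apply: horiz_self_eq0; first exact: profile_dom_int0.
by rewrite -(scale0r 0) horizZ mul0r.
Qed.

Lemma dhoriz0 a : dhoriz phi 0 a 0 = 0.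
Proof. by rewrite -{2}(scale0r 0) dhorizZr mul0r. Qed.

Lemma hess0_neg_semidefinite : neg_semidefinite (hess phi 0).
Proof.
move=> v; have K0 := profile_dom_int0 dP; have dg := profile_diff_grad K0.
rewrite -oppr_ge0 -dhoriz_quad_form// leNgt; apply/negP => vv.
have [|vv0 _] := BCP_dhoriz (b := 0) K0 horiz0 (dhoriz0 v) (ltW vv).
  by rewrite dhoriz0.
by move: vv; rewrite vv0 ltxx.
Qed.

Lemma hess0_neg_definite : neg_definite (hess phi 0).
Proof.
move=> v v0; have K0 := profile_dom_int0 dP; have dg := profile_diff_grad K0.
have nonneg u : 0 <= dhoriz phi 0 u u.
  by rewrite dhoriz_quad_form// oppr_ge0 hess0_neg_semidefinite.
rewrite -oppr_gt0 -dhoriz_quad_form// lt_neqAle nonneg andbT eq_sym.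
apply/eqP => vv.
have v2 := rV2_neq0 v0.
(* A null vector of a nonnegative quadratic form is in the kernel of its polar form; otherwise a
   small multiple of [perp v] added to [v] would give a negative value. *)
have sym : dhoriz phi 0 v (perp v) + dhoriz phi 0 (perp v) v = 0.
  apply/eqP; apply: contraT => m0.
  have [|t] := quadratic_pos
    (m := - (dhoriz phi 0 v (perp v) + dhoriz phi 0 (perp v) v))
    (- dhoriz phi 0 (perp v) (perp v)); first by rewrite oppr_eq0.
  have := nonneg (v + t *: perp v).
  rewrite !(dhorizDr, dhorizZr) !(dhorizDl, dhorizZl) vv leNgt.
  move=> /negP H1 H2; exfalso; apply: H1.
  by rewrite -oppr_gt0; congr (0 < _): H2; ring.
(* The two mixed values have sum 0 and difference [omega v (perp v)], so this one is half of the
   latter. *)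
have vp : dhoriz phi 0 v (perp v) < 0.
  have := dhoriz_antisym v (perp v) dg (hess_profile_sym K0).
  by rewrite omega_perp; lra.
have vv0 : dhoriz phi 0 v v <= 0 by rewrite vv.
have [_ vp0] := BCP_dhoriz K0 horiz0 (dhoriz0 v) vv0 (ltW vp).
by move: vp; rewrite vp0 ltxx.
Qed.

End BCP_profile.

Theorem theorem1p10 (R : realType) (d : heis R -> heis R -> R)
    (phi : 'rV[R]_2 -> R) :
  homogeneous_distance d -> is_profile d phi -> BCP d ->
  C2_on (profile_dom d)° phi ->
  [/\ forall w : 'rV[R]_2, (profile_dom d)° w -> w != 0 -> dotv (grad phi w) w < 0,
      forall w : 'rV[R]_2, profile_dom d w -> w != 0 -> phi w < phi 0,
      neg_semidefinite (hess phi 0) &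
      differentiable (hess phi) 0 -> neg_definite (hess phi 0)].
Proof.
move=> dP phiP dBCP phi_C2; split.
- move=> w Kw w0; have := horiz_self_gt0 dP phiP dBCP phi_C2 Kw w0.
  by rewrite /horiz omegavv mul0r sub0r oppr_gt0.
- exact: (profile_max dP phiP dBCP phi_C2).
- exact: (hess0_neg_semidefinite dP phiP dBCP phi_C2).
- move=> _; exact: (hess0_neg_definite dP phiP dBCP phi_C2).
Qed.
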